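(* Let $q\ge2$ be an integer and let $G$ be the incidence graph of a projective plane of order $q$. For every integer $k\ge q+1$, \[\mathrm{capt}_{\zeta,k}(G)\le\left\lceil\frac{q-1}{k-q}\right\rceil+\left\lceil\frac{q}{k-q+1}\right\rceil.\]
   Context: A (finite) projective plane of order $q$ has $q^2+q+1$ points and $q^2+q+1$ lines, every two distinct points lie on exactly one common line, every two distinct lines meet in exactly one point, each line has $q+1$ points and each point lies on $q+1$ lines. Its incidence graph is the bipartite graph on points and lines, with a point adjacent to a line iff they are incident. The localization game on a connected graph $G$ with $k$ cops: the robber, invisible to the cops, first chooses a starting vertex. In each round the cops choose a multiset of vertices $u_1,\dots,u_k$ (no adjacency restriction) and learn the distances $d(u_i,R)$ to the robber's current vertex $R$; the cops capture the robber if, from all information so far, they can determine the robber's vertex uniquely. If not captured, the robber moves to a neighbor or stays. The robber is omniscient. The localization number $\zeta(G)$ is the least number of cops guaranteeing capture (for these incidence graphs $\zeta(G)=q+1$). For $k\ge\zeta(G)$, $\mathrm{capt}_{\zeta,k}(G)$ is the minimum number of rounds in which $k$ cops can guarantee capture under optimal play. *)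

(* Defs.v *)
From mathcomp Require Import all_boot all_order all_algebra.
Set Implicit Arguments.
Unset Strict Implicit.
Unset Printing Implicit Defensive.

Record projective_plane (P L : finType) (I : P -> L -> bool) (q : nat) : Prop :=
  ProjectivePlane {
    card_points : #|P| = (q ^ 2 + q + 1)%N;
    card_lines : #|L| = (q ^ 2 + q + 1)%N;
    join_line : forall x y : P, x != y -> exists! l : L, I x l /\ I y l;
    meet_point : forall l m : L, l != m -> exists! x : P, I x l /\ I x m;
    card_points_on_line : forall l : L, #|[set x | I x l]| = (q + 1)%N;
    card_lines_through_point : forall x : P, #|[set l | I x l]| = (q + 1)%N
  }.

Definition incidence_graph (P L : finType) (I : P -> L -> bool) :
    rel (P + L)%type :=
  fun u v =>
    match u, v with
    | inl x, inr l => I x l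
    | inr l, inl x => I x l
    | _, _ => false
    end.

Section Localization.

Variables (V : finType) (e : rel V).

(* Length of a shortest path from x to y; a shortest path has fewer than #|V|
   edges, and the value is #|V| when y cannot be reached from x. *)
Definition dist (x y : V) : nat :=
  \big[minn/#|V|]_(n < #|V| |
    [exists p : n.-tuple V, path e x p && (last x p == y)]) n.

(* The robber's vertex in each round; rounds are numbered from 0. *)
Definition trajectory (r : nat -> V) : Prop :=
  forall t, r t.+1 = r t \/ e (r t) (r t.+1).

Variable k : nat.

Definition answer (u : k.-tuple V) (x : V) : k.-tuple nat :=
  [tuple dist (tnth u i) x | i < k].

(* The next probe is chosen from the answers received so far; the earlier
   probes are themselves determined by those answers. *)
Definition strategy : Type := seq (k.-tuple nat) -> k.-tuple V.

(* The answers received in the first t rounds against the robber r. *)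
Fixpoint transcript (s : strategy) (r : nat -> V) (t : nat) :
    seq (k.-tuple nat) :=
  if t is t'.+1 then
    let h := transcript s r t' in rcons h (answer (s h) (r t'))
  else [::].

(* Capture in round t: every trajectory compatible with the answers received
   up to and including that round has the robber at the same vertex. *)
Definition located_in_round (s : strategy) (r : nat -> V) (t : nat) : Prop :=
  forall r' : nat -> V, trajectory r' ->
    transcript s r' t.+1 = transcript s r t.+1 -> r' t = r t.

(* Quantifying over all trajectories after the strategy is fixed accounts for
   the omniscience of the robber. *)
Definition capture_within (m : nat) : Prop :=
  exists s : strategy, forall r : nat -> V, trajectory r ->
    exists2 t, (t < m)%N & located_in_round s r t.

(* There is no capture time when k cops cannot guarantee capture. *)
Definition is_capture_time (c : nat) : Prop :=
  capture_within c /\ forall m, capture_within m -> (c <= m)%N.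

End Localization.

(* Main.v *)
(** Points and lines play symmetric roles, so the game is analysed on a
    bipartite graph in which two vertices on the same side have a common
    neighbour, unique when they are distinct.

    Sweep: fix a line [l] and points [x <> y] on it.  Every round probes the [q]
    points of [l] other than [y], and [k - q] new lines through [x].  A robber on
    a line [<> l] reveals its intersection with [l], hence is confined to [q]
    lines through one point; a robber on a probed line through [x] is confined to
    [q] points of that line.  Otherwise it has been sitting on points, and after
    [ceil ((q - 1) / (k - q))] rounds only [y] and one line through [x] are left.

    Pencil: the robber is on [y] or on a set [T] of points [<> x] of a line [m]
    through [x], and may then move.  The cops probe [k - q + 1] points of [m] and
    [q - 1] points of the line [xy] other than [x], including [y].  The answers
    locate the robber, or confine it to the unprobed part of [T], or to the lines
    joining one point of [xy] to that part, which is the dual situation.  So each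
    round removes [k - q + 1] of the [q] candidates. *)

From Stdlib Require Classical_Prop.
Require Import Defs.
From mathcomp Require Import all_boot all_order all_algebra.
Import Order.TTheory GRing.Theory Num.Theory.

Set Implicit Arguments.
Unset Strict Implicit.
Unset Printing Implicit Defensive.

(** * The game as a recursion on sets of possible positions *)

Section Game.

Variables (V : finType) (e : rel V).

Lemma dist_le_path x p :
  path e x p -> size p < #|V| -> dist e x (last x p) <= size p.
Proof.
move=> xp ltp; rewrite /dist -minEnat.
apply: (bigmin_le_cond (j := Ordinal ltp) _ (fun n : 'I_#|V| => nat_of_ord n)).
by apply/existsP; exists (in_tuple p); rewrite /= xp eqxx.
Qed.

Lemma dist_path x y :
  dist e x y < #|V| -> exists p, [/\ path e x p, last x p = y & size p = dist e x y].
Proof.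
rewrite /dist; set K := \big[_/_]_(_ < _ | _) _.
pose D n := n < #|V| -> exists p, [/\ path e x p, last x p = y & size p = n].
suff: D K by [].
apply: (big_ind D) => [|a b Da Db|n /existsP[p /andP[xp /eqP xy]] _].
- by rewrite /D ltnn.
- by rewrite /minn; case: ifP.
- by exists p; rewrite size_tuple.
Qed.

(** Descent to the least winning number of rounds; [capture_within] quantifies over infinite
    trajectories, so the descent uses excluded middle. *)
Lemma capture_time_exists k m :
  capture_within e k m -> exists2 c, is_capture_time e k c & c <= m.
Proof.
elim/ltn_ind: m => m IH cm.
have [[n ltnm cn]|nlt] := Classical_Prop.classic (exists2 n, n < m & capture_within e k n).
  by have [c cc lecn] := IH n ltnm cn; exists c => //; apply: leq_trans (ltnW ltnm).
exists m => //; split=> // n cn; rewrite leqNgt; apply/negP=> ltnm.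
by apply: nlt; exists n.
Qed.

Definition nbd (A : {set V}) : {set V} := A :|: [set v | [exists u in A, e u v]].

Lemma nbd_sub (A B : {set V}) : A \subset B -> nbd A \subset nbd B.
Proof.
move=> sAB; apply: setUSS => //; apply/subsetP=> v; rewrite !inE.
case/exists_inP=> u uA uv; apply/exists_inP; exists u => //; exact: subsetP uA.
Qed.

Variable k : nat.

(* [S] is the set of possible positions of the robber when a round is about to
   start, its move being already made; [m] rounds remain. *)
Fixpoint win (m : nat) (S : {set V}) : Prop :=
  if m is m'.+1 then
    exists u : k.-tuple V, forall x, x \in S ->
      let A := [set y in S | answer e u y == answer e u x] in
      A \subset [set x] \/ win m' (nbd A)
  else False.

Lemma win_sub m (S S' : {set V}) : S' \subset S -> win m S -> win m S'.
Proof.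
elim: m S S' => //= m IH S S' sS [u Hu]; exists u => x xS'.
have sA : [set y in S' | answer e u y == answer e u x] \subset
          [set y in S | answer e u y == answer e u x].
  by apply/subsetP=> y; rewrite !inE => /andP[/(subsetP sS)-> ->].
case: (Hu x (subsetP sS _ xS')) => [A1|w]; [left|right].
  exact: subset_trans A1.
by apply: IH w; apply: nbd_sub.
Qed.

(** Transcripts grow at the end, whereas [win] recurses on the first round. *)
Lemma transcript_cons (u : k.-tuple V) (f : k.-tuple nat -> strategy V k) r t :
  transcript e (fun h => if h is a :: h' then f a h' else u) r t.+1 =
  answer e u (r 0) ::
    transcript e (f (answer e u (r 0))) (fun i => r i.+1) t.
Proof. by elim: t => [//|t IH]; rewrite [LHS]/= -/(transcript _ _ _ t.+1) IH. Qed.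

Lemma win_strategy m S : win m S ->
  exists s : strategy V k, forall r, trajectory e r -> r 0 \in S ->
    exists2 t, t < m & forall r', trajectory e r' -> r' 0 \in S ->
      transcript e s r' t.+1 = transcript e s r t.+1 -> r' t = r t.
Proof.
elim: m S => [//|m IH] S [u Hu].
pose A x := [set y in S | answer e u y == answer e u x].
have {Hu} Hx x : exists s : strategy V k, x \in S ->
    A x \subset [set x] \/ forall r, trajectory e r -> r 0 \in nbd (A x) ->
    exists2 t, t < m & forall r', trajectory e r' -> r' 0 \in nbd (A x) ->
      transcript e s r' t.+1 = transcript e s r t.+1 -> r' t = r t.
  have [xS|_] := boolP (x \in S); last by exists (fun=> u).
  by case: (Hu x xS) => [|/IH[s Hs]]; [exists (fun=> u); left | exists s; right].
have {IH} [g Hg] := fin_all_exists Hx.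
(* Only the answer is observed, so any position giving it serves as representative; the default
   covers answers that no position of [S] gives. *)
pose f a := if [pick x in S | answer e u x == a] is Some x then g x else fun=> u.
exists (fun h => if h is a :: h' then f a h' else u) => r rtr r0S.
have [x [xS axr fx]] : exists x, [/\ x \in S, answer e u x = answer e u (r 0)
    & f (answer e u (r 0)) = g x].
  rewrite /f; case: pickP => [x /andP[xS /eqP]|/(_ (r 0))]; first by exists x.
  by rewrite /= r0S eqxx.
have inA r' : trajectory e r' -> r' 0 \in S -> answer e u (r' 0) = answer e u (r 0) ->
    r' 0 \in A x /\ r' 1 \in nbd (A x).
  move=> tr' r'0 ans; have r'A : r' 0 \in A x by rewrite inE r'0 ans axr eqxx.
  split=> //; rewrite /nbd inE; case: (tr' 0) => [->|er]; first by rewrite r'A.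
  by apply/orP; right; rewrite inE; apply/exists_inP; exists (r' 0).
have [rA r1] := inA r rtr r0S erefl.
case: (Hg x xS) => [A1|Hs].
  exists 0; first by [].
  move=> r' tr' r'0; move/eqP; rewrite !(transcript_cons u f) eqseq_cons => /andP[/eqP ans _].
  have [r'A _] := inA r' tr' r'0 ans.
  by move: (subsetP A1 _ r'A) (subsetP A1 _ rA); rewrite !inE => /eqP-> /eqP->.
have [t ltm Ht] := Hs (fun i => r i.+1) (fun i => rtr i.+1) r1.
exists t.+1; first by [].
move=> r' tr' r'0 /eqP; rewrite !(transcript_cons u f) eqseq_cons.
move=> /andP[/eqP ans]; rewrite ans fx => /eqP; have [_ r'1] := inA r' tr' r'0 ans.
exact: (Ht (fun i => r' i.+1) (fun i => tr' i.+1) r'1).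
Qed.

Lemma win_capture m : win m setT -> capture_within e k m.
Proof.
move=> /win_strategy[s Hs]; exists s => r tr.
have [t ltm Ht] := Hs r tr (in_setT _).
by exists t => // r' tr' eqt; apply: Ht; rewrite ?in_setT.
Qed.

End Game.

(** * Distances and probes in a bipartite graph with the self-dual plane axioms *)

Section ProjectiveGraph.

Variables (V : finType) (e : rel V) (side : V -> bool) (q k : nat).

Hypotheses (e_sym : symmetric e) (e_side : forall u v, e u v -> side v = ~~ side u).
Hypothesis join_ex : forall u v, side u = side v -> exists2 w, e u w & e v w.
Hypothesis join_uniq : forall a b u v,
  a != b -> e a u -> e b u -> e a v -> e b v -> u = v.

Local Notation N u := [set v | e u v].

Hypotheses (deg : forall u, #|N u| = q.+1) (q_gt1 : 1 < q) (q_lt_k : q < k).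

Local Notation a := (k - q).
Local Notation b := (k - q).+1.

Lemma card_nbrD1 u v : e u v -> #|N u :\ v| = q.
Proof.
by move=> uv; move: (cardsD1 v (N u)); rewrite inE uv deg add1n => -[].
Qed.

Lemma path_side x p : path e x p -> side (last x p) = side x (+) odd (size p).
Proof.
elim: p x => [|y p IH] x /=; first by rewrite addbF.
by case/andP=> /e_side sy /IH ->; rewrite sy addbN addNb.
Qed.

(** A common neighbour gives distance at most 2 on one side; across sides one extra step suffices.
    The bound on [#|V|] matters because [dist] only sees lengths below [#|V|]. *)
Lemma dist_lt4 x y : dist e x y < 4 <= #|V|.
Proof.
have V4 : 3 < #|V|.
  have := max_card (mem (x |: N x)); rewrite cardsU1 inE deg.
  by case exx: (e x x); [move/e_side: exx; case: (side x) | apply: leq_trans].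
rewrite ltnS V4 andbT.
have /card_gt0P[z] : 0 < #|N x| by rewrite deg.
rewrite inE => xz.
have [sxy|/eqP] := eqVneq (side x) (side y).
  have [w xw yw] := join_ex sxy.
  have := @dist_le_path _ e x [:: w; y]; rewrite /= xw e_sym yw => /(_ isT) le2.
  by apply: leq_trans (le2 _) _ => //; apply: ltnW.
move=> sxy; have [|w zw yw] := @join_ex z y.
  by rewrite (e_side xz); move: sxy; case: (side x); case: (side y).
have := @dist_le_path _ e x [:: z; w; y]; rewrite /= xz zw e_sym yw.
by apply.
Qed.

Lemma dist_exists_path x y :
  exists p, [/\ path e x p, last x p = y & size p = dist e x y].
Proof. by have /andP[lt4 le4] := dist_lt4 x y; apply/dist_path/(leq_trans lt4). Qed.

Lemma dist_side x y : side y = side x (+) odd (dist e x y).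
Proof. by have [p [xp <- <-]] := dist_exists_path x y; apply: path_side. Qed.

Lemma dist_eq0 x y : (dist e x y == 0) = (x == y).
Proof.
have [p [_ xy sp]] := dist_exists_path x y; have /andP[_ V4] := dist_lt4 x y.
apply/eqP/eqP=> [d0|<-]; first by move: sp xy; rewrite d0; case: p.
by apply/eqP; rewrite -leqn0 (@dist_le_path _ e x [::]) //; apply: leq_trans V4.
Qed.

Lemma dist_eq1 x y : (dist e x y == 1) = e x y.
Proof.
have [p [xp xy sp]] := dist_exists_path x y; have /andP[_ V4] := dist_lt4 x y.
apply/eqP/idP=> [d1|exy].
  by move: sp xp xy; rewrite d1; case: p => [|z []] //= _; rewrite andbT => + <-.
have := @dist_le_path _ e x [:: y]; rewrite /= exy => /(_ isT (leq_trans _ V4)).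
have := dist_side x y; rewrite (e_side exy).
by case: (dist e x y) => [|[|n]]; [case: (side x) | | move=> _ /(_ isT)].
Qed.

(** Distances are at most 3 and their parity is fixed by the sides, so the side together with the
    tests for distance 0 and 1 determines every answer. *)
Definition agree (D : {set V}) x y :=
  side x = side y /\ forall d, d \in D -> (d == x) = (d == y) /\ e d x = e d y.

Lemma agree_sym D x y : agree D x y -> agree D y x.
Proof. by case=> sxy H; split=> // d /H[]. Qed.

Lemma win_probe n (S D : {set V}) d0 : d0 \in D -> #|D| <= k ->
  (forall x, x \in S ->
     (forall y, y \in S -> agree D x y -> y = x) \/
     exists2 B : {set V}, forall y, y \in S -> agree D x y -> y \in B & win e k n (nbd e B)) ->
  win e k n.+1 S.
Proof.
(* [d0] pads the tuple when [D] has fewer than [k] elements; the parity of its distance reveals the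
   side of the robber. *)
move=> d0D leDk HS; exists [tuple nth d0 (enum D) i | i < k] => x xS A.
have agA y : y \in A -> y \in S /\ agree D x y.
  rewrite inE => /andP[yS /eqP eqa]; split=> //.
  have eqd d : d \in D -> dist e d y = dist e d x.
    move=> dD; have ltd : index d (enum D) < k.
      by apply: leq_trans leDk; rewrite cardE index_mem mem_enum.
    have := congr1 (fun t => tnth t (Ordinal ltd)) eqa.
    by rewrite !tnth_mktuple /= nth_index ?mem_enum.
  split=> [|d /eqd eqdxy]; first by rewrite (dist_side d0 x) (dist_side d0 y) eqd.
  by rewrite -!dist_eq0 -!dist_eq1 eqdxy.
case: (HS x xS) => [H1|[B HB wB]]; [left|right].
  by apply/subsetP=> y /agA[yS yx]; rewrite inE; apply/eqP; apply: H1.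
by apply: win_sub wB; apply: nbd_sub; apply/subsetP=> y /agA[yS yx]; apply: HB.
Qed.

(** A budget of [c] probes is spent on [T] first and the surplus on the rest of [M]: take a prefix
    of an enumeration that lists [T] first. *)
Lemma choose_subset (T M : {set V}) c : T \subset M ->
  exists U : {set V}, [/\ U \subset M, #|U| <= c, minn c #|M| <= #|U|
    & #|T :\: U| <= #|T| - c].
Proof.
move=> sTM; pose s := enum T ++ enum (M :\: T).
have us : uniq s.
  rewrite cat_uniq !enum_uniq andbT /=; apply/hasPn=> v.
  by rewrite !mem_enum inE => /andP[].
have szs : size s = #|M| by rewrite size_cat -!cardE -(cardsID T M) (setIidPr sTM).
have cU : #|[set v in take c s]| = minn c #|M|.
  by rewrite cardsE (card_uniqP (take_uniq _ us)) size_take_min szs.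
exists [set v in take c s]; rewrite cU geq_minl; split=> //.
  apply/subsetP=> v; rewrite inE => /mem_take; rewrite mem_cat !mem_enum.
  by case/orP=> [/(subsetP sTM)|/setDP[]].
rewrite [#|T|]cardE -size_drop; apply: leq_trans (card_size _).
apply: subset_leq_card; apply/subsetP=> v; rewrite !inE => /andP[vn vT].
move: vT; rewrite -mem_enum -{1}(cat_take_drop c (enum T)) mem_cat => /orP[vt|//].
case/negP: vn; rewrite take_cat; case: ltnP => // lec.
by rewrite mem_cat -(take_oversize lec) vt.
Qed.

(** * The pencil phase *)

(* Closed under the robber's moves from [y] only when [T] is all of [N m :\ x]:
   otherwise a line through [y] may miss [T].  This is why the position [y]
   can be allowed at the end of the sweep at no cost. *)
Definition pencil (l y : V) (T : {set V}) : {set V} :=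
  T :|: [set y; l] :|: [set v | [exists t in T, e t v]].

Lemma nbd_pencil l y T : nbd e T \subset pencil l y T.
Proof.
by apply/subsetP=> v; rewrite !inE => /orP[]->; rewrite ?orbT.
Qed.

Lemma win_pencil n m x l y (T : {set V}) :
  e m x -> e l x -> m != l -> e l y -> y != x -> T \subset N m :\ x ->
  #|T| <= n * b -> 0 < n -> win e k n (pencil l y T).
Proof.
elim: n m x l y T => // n IH m x l y T mx lx ml ly yx sT leT _.
have Tm t : t \in T -> e m t /\ t != x.
  by move/(subsetP sT); rewrite !inE => /andP[-> ->].
(* [w] is the point of [l] besides [x] left unprobed, so that [Z] costs [q - 1] probes and [U] can
   have [k - q + 1]. *)
have [w [lw wx wy]] : exists w, [/\ e l w, w != x & w != y].
  have /card_gt0P[w] : 0 < #|N l :\ x :\ y|.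
    have := cardsD1 y (N l :\ x); rewrite !inE yx ly (card_nbrD1 lx) => eqq.
    by move: q_gt1; rewrite {1}eqq; case: #|_|.
  by rewrite !inE => /and3P[? ? ?]; exists w.
pose Z := N l :\ x :\ w.
have cZ : #|Z| = q.-1.
  by move: (cardsD1 w (N l :\ x)); rewrite -/Z !inE wx lw (card_nbrD1 lx) => ->.
have yZ : y \in Z by rewrite !inE yx ly eq_sym wy.
have ZP c : c \in Z -> e l c /\ c != x by rewrite !inE => /and3P[_ -> ->].
have [U [sU leU geU leTU]] := choose_subset b sT.
have UP u : u \in U -> e m u /\ u != x.
  by move/(subsetP sU); rewrite !inE => /andP[-> ->].
rewrite (card_nbrD1 mx) in geU.
(* Two probed points of [m] single out [m] among the lines. *)
have U2 : 1 < #|U|.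
  by apply: leq_trans geU; rewrite leq_min q_gt1 ltnS subn_gt0 q_lt_k.
have leTn : #|T :\: U| <= n * b.
  by apply: leq_trans leTU _; rewrite leq_subLR -mulSn.
have n_gt0 t : t \in T :\: U -> 0 < n.
  move=> tTU; rewrite lt0n; apply: contraTneq leTn => ->.
  by rewrite mul0n -ltnNge; apply/card_gt0P; exists t.
have ml_x t : e m t -> e l t -> t = x by move=> mt lt; apply: join_uniq ml _ _ _ _.
have xm t : t != x -> e m t -> forall v, e t v -> e x v -> v = m.
  by move=> tx mt v tv xv; apply: (join_uniq tx); rewrite // e_sym.
have xl c : c != x -> e l c -> forall v, e c v -> e x v -> v = l.
  by move=> cx lc v cv xv; apply: (join_uniq cx); rewrite // e_sym.
pose D := Z :|: U.
have ZD c : c \in Z -> c \in D by move=> cZ'; rewrite inE cZ'.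
have UD c : c \in U -> c \in D by move=> cU'; rewrite inE cU' orbT.
apply: (@win_probe _ _ D y); first exact: ZD.
  apply: leq_trans (leq_card_setU _ _) _; rewrite cZ.
  apply: leq_trans (leq_add (leqnn _) leU) _.
  by rewrite -addSnnS prednK ?subnKC // ltnW // ltnW.
set S := pencil l y T.
have sl : side l = side m by apply: (can_inj negbK); rewrite -(e_side mx) -(e_side lx).
have Sp v : v \in S -> side v != side m -> v = y \/ v \in T.
  rewrite !inE => /orP[/orP[->|/orP[/eqP->|/eqP->]]|/exists_inP[t tT tv]].
  - by right.
  - by left.
  - by rewrite sl eqxx.
  - by rewrite (e_side tv) (e_side (Tm t tT).1) negbK eqxx.
have Sl v : v \in S -> side v = side m -> v = l \/ exists2 t, t \in T & e t v.
  rewrite !inE => /orP[/orP[vT|/orP[/eqP->|/eqP->]]|/exists_inP[t tT tv]].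
  - by rewrite (e_side (Tm v vT).1); case: (side m).
  - by rewrite (e_side ly) sl; case: (side m).
  - by left.
  - by right; exists t.
move=> v vS; have [sv|sv] := eqVneq (side v) (side m); last first.
  have [vD|vD] := boolP (v \in D).
    left=> v' _ [_ /(_ v vD)[+ _]]; rewrite eqxx => /esym /eqP //.
  have vTU : v \in T :\: U.
    case: (Sp v vS sv) => [vy|vT]; first by rewrite vy ZD in vD.
    by rewrite inE vT andbT; apply: contra vD; apply: UD.
  right; exists (T :\: U).
    move=> v' v'S ag.
    have v'D : v' \notin D.
      by apply: contra vD => v'D; case: (ag.2 v' v'D) => + _; rewrite eqxx => /eqP <-.
    case: (Sp v' v'S); rewrite -?ag.1 //; first by move=> v'y; rewrite v'y ZD in v'D.
    by move=> v'T; rewrite inE v'T andbT; apply: contra v'D; apply: UD.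
  apply: win_sub (nbd_pencil l y _) _; apply: (IH m x) => //.
    by apply: subset_trans (subsetDl _ _) sT.
  exact: n_gt0 vTU.
have agm v1 v2 : agree D v1 v2 -> v1 = m -> v2 = m.
  move=> [_ ag] v1m; have [u1 [u2 [u1U u2U u12]]] := card_gt1P U2.
  have ev u : u \in U -> e u v2.
    by move=> uU; rewrite -(ag u (UD u uU)).2 v1m e_sym (UP u uU).1.
  apply: (join_uniq u12); rewrite ?ev // e_sym; first exact: (UP u1 u1U).1.
  exact: (UP u2 u2U).1.
have agl v1 v2 : v2 \in S -> agree D v1 v2 -> v1 = l -> v2 = l.
  move=> v2S [s12 ag] v1l; case: (Sl v2 v2S) => [|//|[t tT tv2]].
    by rewrite -s12 v1l.
  have ev c : c \in Z -> e c v2.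
    by move=> cZ'; rewrite -(ag c (ZD c cZ')).2 v1l e_sym (ZP c cZ').1.
  (* For [q >= 3] two probes in [Z] single out [l]. For [q = 2] the set [Z] is too small, but then
     [U] is all of [N m :\ x], and [l] avoids it while [v2] meets it. *)
  have [q3|q3] := ltnP 2 q.
    have /card_gt1P[c1 [c2 [c1Z c2Z c12]]] : 1 < #|Z| by rewrite cZ -ltnS prednK // ltnW.
    apply: (join_uniq c12); rewrite ?ev // e_sym; first exact: (ZP c1 c1Z).1.
    exact: (ZP c2 c2Z).1.
  have tU : t \in U.
    have /eqP -> : U == N m :\ x.
      rewrite eqEcard sU (card_nbrD1 mx); apply: leq_trans geU.
      by rewrite leq_min leqnn andbT (leq_trans q3) // ltnS subn_gt0.
    exact: subsetP sT t tT.
  have := (ag t (UD t tU)).2; rewrite tv2 v1l e_sym => lt.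
  by have := (Tm t tT).2; rewrite (ml_x t (Tm t tT).1 lt) eqxx.
have [vm|vm] := eqVneq v m; first by left=> v' _ ag; rewrite vm (agm _ _ ag).
have [vl|vl] := eqVneq v l; first by left=> v' v'S ag; rewrite vl (agl _ _ v'S ag).
have meetl v' : v' \in S -> side v' = side m -> v' != m -> v' != l ->
    exists t c, [/\ t \in T, e t v', e l c, e c v' & c != x].
  move=> v'S sv' v'm v'l; case: (Sl v' v'S sv') => [v'l'|[t tT tv']].
    by rewrite v'l' eqxx in v'l.
  have [|c lc v'c] := @join_ex l v'; first by rewrite sv'.
  exists t, c; split=> //; first by rewrite e_sym.
  (* A line through [x] and through [t] on [m] would be [m] itself. *)
  apply: contraNneq v'm => cx; apply/eqP.
  by apply: (xm t (Tm t tT).2 (Tm t tT).1); rewrite // -cx e_sym.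
have [t [c [tT tv lc cv cx]]] := meetl v vS sv vm vl.
have tc : t != c.
  by apply: contraNneq cx => tc; apply/eqP/ml_x => //; rewrite -tc (Tm t tT).1.
have agP v' : v' \in S -> agree D v v' ->
    [/\ e c v', v' != l & exists2 t', t' \in T & e t' v'].
  move=> v'S ag; have ag' := agree_sym ag.
  have v'm : v' != m by apply: contra_neq vm => /(agm _ _ ag').
  have v'l : v' != l by apply: contra_neq vl => /(agl _ _ vS ag').
  have [t' [c' [t'T t'v' lc' c'v' c'x]]] := meetl v' v'S (etrans (esym ag.1) sv) v'm v'l.
  split=> //; last by exists t'.
  (* Only [w] is an unprobed candidate for the meeting point with [l], so negative answers from [Z]
     determine it too. *)
  have [cZ'|cZ'] := boolP (c \in Z); first by rewrite -(ag.2 c (ZD c cZ')).2.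
  have [c'Z|c'Z] := boolP (c' \in Z).
    suff -> : c = c' by [].
    by apply: (join_uniq vl) => //; rewrite e_sym ?(ag.2 c' (ZD c' c'Z)).2.
  move: cZ' c'Z; rewrite !inE cx c'x lc lc' !andbT !negbK => /eqP-> /eqP <- //.
have [tU|tU] := boolP (t \in U).
  left=> v' v'S ag; have [cv' _ _] := agP v' v'S ag.
  by apply: (join_uniq tc) => //; rewrite -(ag.2 t (UD t tU)).2.
pose B := [set v' | [&& e c v', v' != l & [exists t' in T :\: U, e t' v']]].
right; exists B.
  move=> v' v'S ag; have [cv' v'l [t' t'T t'v']] := agP v' v'S ag.
  rewrite inE cv' v'l; apply/exists_inP; exists t' => //; rewrite inE t'T andbT.
  apply: contra tU => t'U; suff -> : t = t' by [].
  apply: (join_uniq vm); rewrite ?(Tm t tT).1 ?(Tm t' t'T).1 // e_sym //.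
  by rewrite (ag.2 t' (UD t' t'U)).2.
have leB : #|B| <= #|T :\: U|.
  (* [j t'] is the line joining [c] to [t']; such lines exhaust [B]. *)
  pose j t' := odflt v [pick v' | e c v' && e t' v'].
  apply: leq_trans (leq_imset_card j _); apply: subset_leq_card.
  apply/subsetP=> v'; rewrite inE => /and3P[cv' v'l /exists_inP[t' t'TU t'v']].
  apply/imsetP; exists t' => //; rewrite /j; case: pickP => [v2 /andP[cv2 t'v2]|].
    have [t'T _] := setDP t'TU.
    have t'c : t' != c.
      by apply: contraNneq cx => t'c; apply/eqP/ml_x => //; rewrite -t'c (Tm t' t'T).1.
    by apply: (join_uniq t'c).
  by move/(_ v'); rewrite cv' t'v'.
(* The dual position: [c], [l], [x], [m] take the roles of [m], [x], [l], [y]. *)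
apply: win_sub (nbd_pencil x m _) _; apply: (IH c l) => //.
- by rewrite e_sym.
- by rewrite e_sym.
- by rewrite e_sym.
- by apply/subsetP=> v'; rewrite !inE => /and3P[-> ->].
- exact: leq_trans leB leTn.
- by apply: (n_gt0 t); rewrite inE tU.
Qed.

(** Settles the sweep branches that confine the robber to [q] neighbours of one vertex. Any second
    line through [x] and any further point on it complete a pencil. *)
Lemma win_line n m x : e m x -> q <= n * b -> win e k n (nbd e (N m :\ x)).
Proof.
move=> mx leq.
have n0 : 0 < n by case: n leq => //; rewrite leqNgt (ltnW q_gt1).
have /card_gt0P[l] : 0 < #|N x :\ m| by rewrite card_nbrD1 1?e_sym // ltnW.
rewrite !inE => /andP[lm xl].
have /card_gt0P[y] : 0 < #|N l :\ x| by rewrite card_nbrD1 1?e_sym // ltnW.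
rewrite !inE => /andP[yx ly].
apply: win_sub (nbd_pencil l y _) _; apply: (@win_pencil _ m x) => //.
- by rewrite e_sym.
- by rewrite eq_sym.
- by rewrite card_nbrD1.
Qed.

(** * The sweep phase *)

Section Sweep.

Variables (l x y : V).
Hypotheses (lx : e l x) (ly : e l y) (yx : y != x).

Definition off_line (R : {set V}) : {set V} :=
  y |: [set v | (v != x) && [exists r in R, e r v]].

Definition unswept (R : {set V}) : {set V} :=
  [set v | [|| side v == side l, e l v | [exists r in R, e r v]]].

Lemma win_sweep_step n (R : {set V}) : q <= n * b -> R \subset N x :\ l ->
  (forall R' : {set V}, R' \subset R -> #|R'| <= #|R| - a ->
     win e k n (nbd e (off_line R'))) ->
  win e k n.+1 (unswept R).
Proof.
move=> leq sR wR; have [U [sU leU _ leRU]] := choose_subset a (subxx R).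
have RP r : r \in R -> e x r /\ r != l.
  by move/(subsetP sR); rewrite !inE => /andP[-> ->].
pose Z := N l :\ y; pose D := Z :|: U.
have cZ : #|Z| = q by apply: card_nbrD1.
have ZD c : c \in Z -> c \in D by move=> cZ'; rewrite inE cZ'.
have UD c : c \in U -> c \in D by move=> cU'; rewrite inE cU' orbT.
have xZ : x \in Z by rewrite !inE eq_sym yx lx.
apply: (@win_probe _ _ D x); first exact: ZD.
  apply: leq_trans (leq_card_setU _ _) _; rewrite cZ.
  by rewrite -leq_subRL // ltnW.
set S := unswept R => v vS.
have agl v1 v2 : agree D v1 v2 -> v1 = l -> v2 = l.
  move=> [s12 ag] v1l.
  have /card_gt1P[c1 [c2 [c1Z c2Z c12]]] : 1 < #|Z| by rewrite cZ.
  have lZ c : c \in Z -> e c l by rewrite !inE e_sym => /andP[].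
  have ev c : c \in Z -> e c v2.
    by move=> cZ'; rewrite -(ag c (ZD c cZ')).2 v1l lZ.
  by apply: (join_uniq c12); rewrite ?ev ?lZ.
have [sv|sv] := eqVneq (side v) (side l).
  have [vl|vl] := eqVneq v l; first by left=> v' _ ag; rewrite vl (agl _ _ ag).
  have [|c lc vc] := @join_ex l v; first by rewrite sv.
  (* Only [y] is unprobed on [l], so the meeting point [c] is known, by its own probe or by
     elimination. *)
  right; exists (N c :\ l); last by apply: win_line; rewrite // e_sym.
  move=> v' v'S ag; have ag' := agree_sym ag.
  have v'l : v' != l by apply: contra_neq vl => /(agl _ _ ag').
  rewrite !inE v'l /=.
  have [cZ'|cZ'] := boolP (c \in Z); first by rewrite -(ag.2 c (ZD c cZ')).2 e_sym.
  have [|c' lc' v'c'] := @join_ex l v'; first by rewrite -ag.1 sv.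
  have [c'Z|c'Z] := boolP (c' \in Z).
    suff -> : c = c' by rewrite e_sym.
    apply: (join_uniq vl) => //.
    by rewrite e_sym (ag.2 c' (ZD c' c'Z)).2 e_sym.
  move: cZ' c'Z; rewrite !inE lc lc' !andbT !negbK => /eqP-> /eqP <-.
  by rewrite e_sym.
have [vD|vD] := boolP (v \in D).
  by left=> v' _ [_ /(_ v vD)[+ _]]; rewrite eqxx => /esym /eqP.
have agD v' : agree D v v' -> v' \notin D.
  by move=> ag; apply: contra vD => v'D; case: (ag.2 v' v'D) => + _; rewrite eqxx => /eqP <-.
have [/exists_inP[r rU rv]|nrU] := boolP [exists r in U, e r v]; right.
  have [xr _] := RP r (subsetP sU r rU).
  exists (N r :\ x); last by apply: win_line; rewrite // e_sym.
  move=> v' _ ag; rewrite !inE -(ag.2 r (UD r rU)).2 rv andbT.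
  by apply: contraNneq (agD v' ag) => ->; apply: ZD.
exists (off_line (R :\: U)); last by apply: wR; rewrite ?subsetDl.
move=> v' v'S ag; rewrite in_setU1; have [//|v'y /=] := eqVneq v' y.
have v'D := agD v' ag; rewrite !inE.
have -> /= : v' != x by apply: contraNneq v'D => ->; apply: ZD.
move: v'S; rewrite !inE -ag.1 (negbTE sv) /=.
case/orP=> [lv'|/exists_inP[r rR rv']].
  by case/negP: v'D; apply: ZD; rewrite !inE v'y.
apply/exists_inP; exists r => //; rewrite inE rR andbT.
apply: contra nrU => rU; apply/exists_inP; exists r => //.
by rewrite (ag.2 r (UD r rU)).2.
Qed.

Lemma win_sweep n n2 (R : {set V}) : q <= n2 * b -> R \subset N x :\ l ->
  #|R| <= n * a + 1 -> win e k (n + n2) (nbd e (off_line R)).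
Proof.
move=> leq; have n2_gt0 : 0 < n2 by case: n2 leq => //; rewrite leqNgt (ltnW q_gt1).
have RP (R' : {set V}) r : R' \subset N x :\ l -> r \in R' -> e x r /\ r != l.
  by move=> sR /(subsetP sR); rewrite !inE => /andP[-> ->].
elim: n R => [|n IH] R sR leR.
  (* At most one line of [R] is left; if there is none, any line through [x] other than [l]
     serves. *)
  have [r sr xr] : exists2 r, R \subset [set r] & r \in N x :\ l.
    have [->|[r rR]] := set_0Vmem R.
      have /card_gt0P[r rx] : 0 < #|N x :\ l| by rewrite card_nbrD1 1?e_sym // ltnW.
      by exists r; rewrite ?sub0set.
    exists r; last exact: subsetP rR.
    by apply/subsetP=> r' r'R; rewrite inE; apply/eqP; have /card_le1_eqP := leR; apply.
  have [{}xr rl] := RP _ r (subxx _) xr.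
  have rx : e r x by rewrite e_sym.
  have sr' v : v \in off_line R -> v = y \/ v \in N r :\ x.
    rewrite !inE => /orP[/eqP|/andP[-> /exists_inP[r' /(subsetP sr)]]]; first by left.
    by rewrite inE => /eqP-> ->; right.
  apply: win_sub (@win_pencil n2 r x l y (N r :\ x) _ _ _ _ _ _ _ _) => //; last first.
    by rewrite card_nbrD1.
  apply/subsetP=> v; rewrite 2!inE => /orP[|/exists_inP[u]] /sr'[->|vr].
  - by rewrite !inE eqxx !orbT.
  - by rewrite !in_setU vr.
  (* A line through [y] other than [l] misses [x], hence meets [r] in [N r :\ x], which is the whole
     of [T] here. *)
  - move=> yv; have [->|vl] := eqVneq v l; first by rewrite !inE eqxx !orbT.
    have [|t rt vt] := @join_ex r v.
      by rewrite (e_side yv) (e_side ly) -(e_side lx) -(e_side xr).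
    rewrite inE; apply/orP; right; rewrite inE; apply/exists_inP.
    exists t; last by rewrite e_sym.
    rewrite !inE rt andbT; apply: contra_neq vl => tx.
    by apply: (join_uniq yx) => //; rewrite e_sym // -tx.
  - move=> uv; rewrite inE; apply/orP; right; rewrite inE; apply/exists_inP.
    by exists u.
(* Staying keeps the robber on [y] or on a line of [R]; moving puts it on the side of [l]. *)
apply: win_sub (@win_sweep_step (n + n2) R _ sR _).
- apply/subsetP=> v; rewrite !inE -orbA => /or3P[/eqP->|/andP[_ ->]|/exists_inP[u]].
  + by rewrite ly orbT.
  + by rewrite !orbT.
  rewrite !inE => su uv; apply/orP; left; apply/eqP; rewrite (e_side uv).
  case/orP: su => [/eqP->|/andP[_ /exists_inP[r rR ru]]].
    by rewrite (e_side ly) negbK.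
  by rewrite (e_side ru) negbK (e_side (RP R r sR rR).1) (e_side lx) negbK.
- by apply: leq_trans leq _; rewrite leq_mul2r leq_addl orbT.
- move=> R' sR' leR'; apply: IH; first exact: subset_trans sR' sR.
  by apply: leq_trans leR' _; rewrite leq_subLR addnA -mulSn.
Qed.

End Sweep.

Lemma win_all (v0 : V) n1 n2 : q - 1 <= n1 * a -> q <= n2 * b ->
  win e k (n1 + n2) [set: V].
Proof.
case: n1 => [|n]; first by rewrite leqNgt subn_gt0 q_gt1.
move=> leq1 leq2.
have /card_gt1P[x [y [lx ly xy]]] : 1 < #|N v0| by rewrite deg ltnW.
rewrite !inE in lx ly; have xl : e x v0 by rewrite e_sym.
apply: win_sub (@win_sweep_step v0 x y lx ly _ (n + n2) (N x :\ v0) _ (subxx _) _).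
- apply/subsetP=> v _; rewrite inE; case: eqVneq => //= sv.
  have [->|vx] := eqVneq v x; first by rewrite lx.
  have [|r vr xr] := @join_ex v x.
    by rewrite (e_side lx); move: sv; case: (side v); case: (side v0).
  have [rl|rl] := eqVneq r v0; first by rewrite -rl e_sym vr.
  apply/orP; right; apply/exists_inP; exists r; first by rewrite !inE rl.
  by rewrite e_sym.
- by rewrite eq_sym.
- by apply: leq_trans leq2 _; rewrite leq_mul2r leq_addl orbT.
move=> R' sR' leR'; apply: (win_sweep lx ly) => //; first by rewrite eq_sym.
(* At most [q - a] lines remain and one may stay unswept, whence [q - 1] in the first ceiling. *)
rewrite (card_nbrD1 xl) in leR'; apply: leq_trans leR' _.
by rewrite leq_subLR addnA -mulSn addnC -leq_subLR.
Qed.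

End ProjectiveGraph.

(** * Incidence graphs of projective planes satisfy the axioms *)

Section IncidenceGraph.

Variables (P L : finType) (I : P -> L -> bool) (q : nat).
Hypothesis planeI : projective_plane I q.

Let e := incidence_graph I.
Let side (u : P + L) := if u is inl _ then true else false.

Lemma incidence_sym : symmetric e.
Proof. by move=> [x|l] [y|m]. Qed.

Lemma incidence_side u v : e u v -> side v = ~~ side u.
Proof. by case: u v => [x|l] [y|m]. Qed.

Lemma incidence_deg u : #|[set v | e u v]| = q.+1.
Proof.
rewrite -addn1; case: u => [x|l].
  rewrite -(card_lines_through_point planeI x) -(card_imset _ (@inr_inj P L)).
  apply: eq_card => -[y|l]; rewrite !inE /=.
    by apply/esym/imsetP=> -[].
  by rewrite (mem_imset _ _ inr_inj) inE.
rewrite -(card_points_on_line planeI l) -(card_imset _ (@inl_inj P L)).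
apply: eq_card => -[x|m]; rewrite !inE /=.
  by rewrite (mem_imset _ _ inl_inj) inE.
by apply/esym/imsetP=> -[].
Qed.

Lemma incidence_join u v : side u = side v -> exists2 w, e u w & e v w.
Proof.
have [<- _|] := eqVneq u v.
  have /card_gt0P[w] : 0 < #|[set w | e u w]| by rewrite incidence_deg.
  by rewrite inE; exists w.
case: u v => [x|l] [y|m] //= uv _.
  by have [l [[xl yl] _]] := join_line planeI uv; exists (inr l).
by have [x [[xl xm] _]] := meet_point planeI uv; exists (inl x).
Qed.

Lemma incidence_join_unique a b u v :
  a != b -> e a u -> e b u -> e a v -> e b v -> u = v.
Proof.
case: a b u v => [x|l] [y|m] [x'|l'] [y'|m'] //= ab au bu av bv.
  by have [l [_ H]] := join_line planeI ab; rewrite -(H l') // -(H m').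
by have [x [_ H]] := meet_point planeI ab; rewrite -(H x') // -(H y').
Qed.

Lemma incidence_capture_within k n1 n2 : 1 < q -> q < k ->
  q - 1 <= n1 * (k - q) -> q <= n2 * (k - q).+1 -> capture_within e k (n1 + n2).
Proof.
move=> q_gt1 ltqk leq1 leq2; apply: win_capture.
have /card_gt0P[x _] : 0 < #|P| by rewrite (card_points planeI) addn1.
exact: (win_all incidence_sym incidence_side incidence_join
  incidence_join_unique incidence_deg q_gt1 ltqk (inl x) leq1 leq2).
Qed.

End IncidenceGraph.

(** * From natural-number bounds to rational ceilings *)

Local Open Scope ring_scope.

Lemma ceil_div_nat (m d : nat) : (0 < d)%N ->
  exists2 n : nat, (m <= n * d)%N & Num.ceil (m%:R / d%:R : rat) = n%:Z.
Proof.
move=> d0; have d0' : 0 < d%:R :> rat by rewrite ltr0n.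
have c0 : 0 <= Num.ceil (m%:R / d%:R : rat).
  (* A ceiling is nonnegative as soon as its argument exceeds [-1]. *)
  by rewrite ceil_ge0 (lt_le_trans (ltrN10 _)) // divr_ge0 ?ler0n.
exists `|Num.ceil (m%:R / d%:R : rat)|%N; last by rewrite gez0_abs.
rewrite -(ler_nat rat) natrM -ler_pdivrMr //.
by apply: le_trans (ceil_ge _) _; rewrite natr_absz ger0_norm.
Qed.

Unset Implicit Arguments.
Set Strict Implicit.
Set Printing Implicit Defensive.

Theorem mainTheorem16 (q : nat) (hq : (2 <= q)%N) (P L : finType)
    (I : P -> L -> bool) (hI : projective_plane I q)
    (k : nat) (hk : (q + 1 <= k)%N) :
  exists2 c : nat, is_capture_time (incidence_graph I) k c &
    c%:Z <= Num.ceil ((q%:Q - 1) / (k%:Q - q%:Q))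
            + Num.ceil (q%:Q / (k%:Q - q%:Q + 1)).
Proof.
rewrite addn1 in hk.
have [|n1 le1 ceil1] := @ceil_div_nat (q - 1) (k - q); first by rewrite subn_gt0.
have [n2 le2 ceil2] := @ceil_div_nat q (k - q).+1 isT.
have [c cc lec] := capture_time_exists (incidence_capture_within hI hq hk le1 le2).
exists c => //.
have -> : q%:Q - 1 = (q - 1)%:R by rewrite natrB // ltnW.
have -> : k%:Q - q%:Q = (k - q)%:R by rewrite natrB // ltnW.
by rewrite natr1 ceil1 ceil2 -PoszD lez_nat.
Qed.
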